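(* Let $\theta, a:\mathbb{R}\to\mathbb{R}$ be $C^\infty$ functions such that the straight line family $\mathcal{L}=\{L_{(\theta(t),a(t))}\}_{t\in\mathbb{R}}$ in the plane $\mathbb{R}^2$ is creative, and let $f:\mathbb{R}\to\mathbb{R}^2$ be any envelope created by $\mathcal{L}$. Then the widespread method represents $f$ precisely, i.e. $\mathcal{D}_t=\{f(t)\}$ for every $t\in\mathbb{R}$, if and only if the Gauss mapping $\nu:\mathbb{R}\to S^1$ of $\mathcal{L}$ is non-singular.
   Context: For $C^\infty$ functions $\theta,a:\mathbb{R}\to\mathbb{R}$, the straight line family $\mathcal{L}=\{L_{(\theta(t),a(t))}\}_{t\in\mathbb{R}}$ consists of the lines $L_{(\theta(t),a(t))}=\{(X,Y)\in\mathbb{R}^2 \mid X\cos\theta(t)+Y\sin\theta(t)=a(t)\}$. Its Gauss mapping is $\nu:\mathbb{R}\to S^1$, $\nu(t)=(\cos\theta(t),\sin\theta(t))$. A point $t$ is a regular point of $\nu$ if $\frac{d\nu}{dt}(t)\neq 0$ (equivalently $\frac{d\theta}{dt}(t)\ne 0$), and a singular point otherwise; $\nu$ is non-singular if every $t\in\mathbb{R}$ is a regular point. The family $\mathcal{L}$ is creative if there exists a $C^\infty$ function $b:\mathbb{R}\to\mathbb{R}$ such that $\frac{da}{dt}(t)=b(t)\frac{d\theta}{dt}(t)$ for all $t\in\mathbb{R}$. An envelope created by $\mathcal{L}$ is a $C^\infty$ mapping $f:\mathbb{R}\to\mathbb{R}^2$ such that for every $t\in\mathbb{R}$: (a) $\frac{df}{dt}(t)\cdot\nu(t)=0$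 (standard scalar product), and (b) $f(t)\in L_{(\theta(t),a(t))}$. Put $G(X,Y,t)=X\cos\theta(t)+Y\sin\theta(t)-a(t)$. The widespread method consists in solving, for each $t$, the system $G=\frac{\partial G}{\partial t}=0$, i.e. computing $$\mathcal{D}_t=\left\{(X,Y)\in\mathbb{R}^2 \;\middle|\; G(X,Y,t)=\frac{\partial G}{\partial t}(X,Y,t)=0\right\},$$ whose union over $t\in\mathbb{R}$ is the discriminant set $\mathcal{D}$. *)

(* Defs.v *)
From Stdlib Require Import Reals.
From Coquelicot Require Import Coquelicot.

Open Scope R_scope.

(** Stdlib's real numbers, with Coquelicot.  The plane is [R * R], a subset of
    it is a predicate, and a map into it is differentiated componentwise. *)

Definition smooth (g : R -> R) : Prop :=
  forall (n : nat) (t : R), ex_derive_n g n t.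

Definition smooth2 (f : R -> R * R) : Prop :=
  smooth (fun t => fst (f t)) /\ smooth (fun t => snd (f t)).

(** [Derive] is total, with a meaningless value where the derivative does not
    exist; below it is only applied to smooth functions. *)
Definition Derive2 (f : R -> R * R) (t : R) : R * R :=
  (Derive (fun s => fst (f s)) t, Derive (fun s => snd (f s)) t).

Definition dot (u v : R * R) : R := fst u * fst v + snd u * snd v.

Definition line (theta a : R) (P : R * R) : Prop :=
  fst P * cos theta + snd P * sin theta = a.

Definition gauss (theta : R -> R) (t : R) : R * R :=
  (cos (theta t), sin (theta t)).

(** [gauss theta] takes its values in the unit circle; its velocity is taken
    in the ambient plane. *)
Lemma gauss_unit (theta : R -> R) (t : R) :
  dot (gauss theta t) (gauss theta t) = 1.
Proof.
  generalize (sin2_cos2 (theta t)); unfold dot, gauss, Rsqr; simpl.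
  rewrite Rplus_comm; trivial.
Qed.

Definition regular_point (nu : R -> R * R) (t : R) : Prop :=
  Derive2 nu t <> (0, 0).

Definition non_singular (nu : R -> R * R) : Prop :=
  forall t : R, regular_point nu t.

Definition creative (theta a : R -> R) : Prop :=
  exists b : R -> R,
    smooth b /\ forall t : R, Derive a t = b t * Derive theta t.

Definition envelope (theta a : R -> R) (f : R -> R * R) : Prop :=
  smooth2 f /\
  forall t : R,
    dot (Derive2 f t) (gauss theta t) = 0 /\ line (theta t) (a t) (f t).

Definition G (theta a : R -> R) (X Y t : R) : R :=
  X * cos (theta t) + Y * sin (theta t) - a t.

Definition discriminant_at (theta a : R -> R) (t : R) (P : R * R) : Prop :=
  G theta a (fst P) (snd P) t = 0 /\
  Derive (fun s => G theta a (fst P) (snd P) s) t = 0.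

(** The set [discriminant_at theta a t] is the singleton of [f t], for all [t]. *)
Definition represents_precisely (theta a : R -> R) (f : R -> R * R) : Prop :=
  forall (t : R) (P : R * R), discriminant_at theta a t P <-> P = f t.

(* Main.v *)
Require Import Defs.
From Stdlib Require Import Reals Lra.
From Coquelicot Require Import Coquelicot.

(** Write [nu = (cos theta, sin theta)] and [mu = (- sin theta, cos theta)] for
    the moving orthonormal frame of the line family, so that
    [nu' = theta' mu] and the system [G = dG/dt = 0] reads
    [P . nu = a], [theta' (P . mu) = a'].

    An envelope always solves this system: differentiating [f . nu = a] gives
    [f' . nu + theta' (f . mu) = a'], and the first term vanishes because [f]
    is tangent to the lines ([envelope_second_equation]).  Subtracting the
    system for [f t] from the one for [P] leaves the homogeneous system
    [(P - f t) . nu = 0], [theta' ((P - f t) . mu) = 0]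
    ([discriminant_at_relative_to_envelope]).  Its solutions in the frame
    [(nu, mu)] are evident: only [P = f t] when [theta' <> 0], and the whole
    line [f t + R mu] when [theta' = 0].  Finally [nu' = theta' mu] with [mu] a
    unit vector, so [theta' <> 0] says exactly that the Gauss mapping is
    regular ([regular_point_gauss]). *)

(** The derivative of [gauss] is [Derive theta] times this unit vector. *)
Definition tangent (theta : R -> R) (t : R) : R * R :=
  (- sin (theta t), cos (theta t)).

Lemma smooth_ex_derive (g : R -> R) (t : R) : smooth g -> ex_derive g t.
Proof. intros g_smooth; exact (g_smooth 1%nat t). Qed.

Lemma cos2_plus_sin2 (x : R) : cos x * cos x + sin x * sin x = 1.
Proof. generalize (sin2_cos2 x); unfold Rsqr; lra. Qed.

(** [gauss] and [tangent] form an orthonormal basis, so [P - Q] vanishes as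
    soon as both of its coordinates in that basis do. *)
Lemma frame_separates_points (theta : R -> R) (t : R) (P Q : R * R) :
  dot P (gauss theta t) = dot Q (gauss theta t) ->
  dot P (tangent theta t) = dot Q (tangent theta t) ->
  P = Q.
Proof.
  destruct P as [X Y], Q as [x y]; unfold dot, gauss, tangent; simpl.
  set (c := cos (theta t)); set (s := sin (theta t)); intros E1 E2.
  assert (U : c * c + s * s = 1) by apply cos2_plus_sin2.
  f_equal.
  - replace X with (c * (X * c + Y * s) - s * (X * - s + Y * c)
                    + X * (1 - (c * c + s * s))) by ring.
    rewrite E1, E2, U; replace x with (x * (c * c + s * s)) at 3
      by (rewrite U; ring); ring.
  - replace Y with (s * (X * c + Y * s) + c * (X * - s + Y * c)
                    + Y * (1 - (c * c + s * s))) by ring.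
    rewrite E1, E2, U; replace y with (y * (c * c + s * s)) at 3
      by (rewrite U; ring); ring.
Qed.

Lemma Derive2_gauss (theta : R -> R) (t : R) :
  ex_derive theta t ->
  Derive2 (gauss theta) t =
  (Derive theta t * fst (tangent theta t), Derive theta t * snd (tangent theta t)).
Proof.
  intros Ht; unfold Derive2, gauss, tangent; simpl; f_equal;
    apply is_derive_unique; auto_derive; trivial;
    change (fun s => theta s) with theta; ring.
Qed.

Lemma regular_point_gauss (theta : R -> R) (t : R) :
  ex_derive theta t ->
  regular_point (gauss theta) t <-> Derive theta t <> 0.
Proof.
  intros Ht; unfold regular_point; rewrite (Derive2_gauss theta t Ht).
  unfold tangent; simpl; split; intros H E; apply H.
  - rewrite E; f_equal; ring.
  - injection E; intros E2 E1.
    set (d := Derive theta t) in *.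
    (* The tangent is a unit vector: pairing [theta' mu] with it returns
       [theta'] itself. *)
    replace d with (d * (cos (theta t) * cos (theta t) + sin (theta t) * sin (theta t)))
      by (rewrite cos2_plus_sin2; ring).
    replace (d * _) with
      ((d * cos (theta t)) * cos (theta t) - (d * - sin (theta t)) * sin (theta t))
      by ring.
    rewrite E1, E2; ring.
Qed.

(** The product rule for [p . nu], with [nu' = theta' mu]. *)
Lemma Derive_dot_gauss (theta : R -> R) (p : R -> R * R) (t : R) :
  ex_derive theta t ->
  ex_derive (fun s => fst (p s)) t -> ex_derive (fun s => snd (p s)) t ->
  Derive (fun s => dot (p s) (gauss theta s)) t =
  dot (Derive2 p t) (gauss theta t) + Derive theta t * dot (p t) (tangent theta t).
Proof.
  intros Ht; unfold dot, gauss, tangent, Derive2; simpl.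
  (* Abstract the coordinates of [p] to real functions [x] and [y]. *)
  change (fst (p t)) with ((fun s => fst (p s)) t).
  change (snd (p t)) with ((fun s => snd (p s)) t).
  change (fun s => fst (p s) * cos (theta s) + snd (p s) * sin (theta s))
    with (fun s => (fun s => fst (p s)) s * cos (theta s)
                   + (fun s => snd (p s)) s * sin (theta s)).
  generalize (fun s => fst (p s)) (fun s => snd (p s)); intros x y Hx Hy.
  apply is_derive_unique; auto_derive; [tauto|].
  change (fun s => theta s) with theta; change (fun s => x s) with x;
    change (fun s => y s) with y; ring.
Qed.

Lemma discriminant_at_frame (theta a : R -> R) (t : R) (P : R * R) :
  ex_derive theta t -> ex_derive a t ->
  discriminant_at theta a t P <->
  dot P (gauss theta t) = a t /\
  Derive theta t * dot P (tangent theta t) = Derive a t.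
Proof.
  intros Ht Ha; unfold discriminant_at.
  assert (D : Derive (fun s => G theta a (fst P) (snd P) s) t =
              Derive theta t * dot P (tangent theta t) - Derive a t).
  { apply is_derive_unique; unfold G, dot, tangent; auto_derive; [tauto|].
    simpl; change (fun s => theta s) with theta;
    change (fun s => a s) with a; ring. }
  rewrite D; unfold G, dot, gauss; simpl; split; intros [E1 E2]; split; lra.
Qed.

(** Differentiate [f . nu = a]; tangency kills the term [f' . nu]. *)
Lemma envelope_second_equation (theta a : R -> R) (f : R -> R * R) (t : R) :
  ex_derive theta t -> envelope theta a f ->
  Derive theta t * dot (f t) (tangent theta t) = Derive a t.
Proof.
  intros Ht [[f1_smooth f2_smooth] Hf].
  destruct (Hf t) as [Tangency _].
  rewrite (Derive_ext a (fun s => dot (f s) (gauss theta s)))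
    by (intros s; symmetry; apply (Hf s)).
  rewrite (Derive_dot_gauss theta f t Ht
    (smooth_ex_derive _ t f1_smooth) (smooth_ex_derive _ t f2_smooth)).
  rewrite Tangency; ring.
Qed.

(** [f t] is a particular solution of the linear system defining the
    discriminant, so the other solutions differ from it by solutions of the
    homogeneous system. *)
Lemma discriminant_at_relative_to_envelope
  (theta a : R -> R) (f : R -> R * R) (t : R) (P : R * R) :
  ex_derive theta t -> ex_derive a t -> envelope theta a f ->
  discriminant_at theta a t P <->
  dot P (gauss theta t) = dot (f t) (gauss theta t) /\
  Derive theta t * dot P (tangent theta t)
  = Derive theta t * dot (f t) (tangent theta t).
Proof.
  intros Ht Ha Hf.
  rewrite (discriminant_at_frame theta a t P Ht Ha),
    (envelope_second_equation theta a f t Ht Hf).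
  replace (dot (f t) (gauss theta t)) with (a t)
    by (symmetry; apply (proj2 Hf t)).
  reflexivity.
Qed.

(** If [Derive theta t = 0], only the equation of the line remains, and the
    discriminant contains [f t + mu] besides [f t]. *)
Lemma discriminant_at_singleton_iff
  (theta a : R -> R) (f : R -> R * R) (t : R) :
  ex_derive theta t -> ex_derive a t -> envelope theta a f ->
  (forall P : R * R, discriminant_at theta a t P <-> P = f t) <->
  Derive theta t <> 0.
Proof.
  intros Ht Ha Hf; split.
  - intros Single D0.
    assert (E : (fst (f t) - sin (theta t), snd (f t) + cos (theta t)) = f t).
    { apply Single.
      apply (discriminant_at_relative_to_envelope theta a f t _ Ht Ha Hf).
      rewrite D0; unfold dot, gauss; simpl; split; ring. }
    rewrite (surjective_pairing (f t)) in E; simpl in E.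
    injection E; intros E2 E1.
    assert (C0 : cos (theta t) = 0) by lra.
    assert (S0 : sin (theta t) = 0) by lra.
    generalize (cos2_plus_sin2 (theta t)); rewrite C0, S0; lra.
  - intros D0 P.
    rewrite (discriminant_at_relative_to_envelope theta a f t P Ht Ha Hf).
    split.
    + intros [E1 E2]; apply (frame_separates_points theta t); trivial.
      exact (Rmult_eq_reg_l _ _ _ E2 D0).
    + intros ->; split; reflexivity.
Qed.

Theorem corollary5 (theta a : R -> R)
  (theta_smooth : smooth theta) (a_smooth : smooth a)
  (L_creative : creative theta a)
  (f : R -> R * R) (f_envelope : envelope theta a f) :
  represents_precisely theta a f <-> non_singular (gauss theta).
Proof.
  assert (Pointwise : forall t : R,
    (forall P : R * R, discriminant_at theta a t P <-> P = f t) <->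
    regular_point (gauss theta) t).
  { intros t.
    assert (Ht := smooth_ex_derive theta t theta_smooth).
    rewrite (regular_point_gauss theta t Ht).
    apply discriminant_at_singleton_iff; trivial.
    apply smooth_ex_derive; trivial. }
  split; intros H t; apply Pointwise, H.
Qed.
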